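(* Let $G$ be a compact group of $*$-automorphisms of a $C^*$-algebra $\mathcal A$ and let $\varphi$ be a faithful $G$-strongly quasi-invariant state on $\mathcal A$ such that $g\mapsto x_g\in\mathcal A$ is continuous and $g\mapsto U_g$ is strongly continuous. Let $\mathfrak A=\pi(\mathcal A)''$ be the von Neumann algebra of the GNS representation of $(\mathcal A,\varphi)$, let $\psi_G$ be the state on $\mathfrak A$ defined in the context, and let $\mathfrak B:=\mathrm{Fix}(u_G)=\{x\in\mathfrak A: u_g(x)=x\ \ \forall g\in G\}$. Then the map $$E:(\mathfrak A,\psi_G)\to\mathfrak B,\qquad E(x):=\int_G u_g(x)\,dg,\quad x\in\mathfrak A,$$ is an Umegaki conditional expectation.
   Context: A faithful state $\varphi$ on $\mathcal A$ is $G$-strongly quasi-invariant if for every $g\in G$ there is a self-adjoint $x_g\in\mathcal A$ with $\varphi(g(a))=\varphi(x_g a)$ for all $a\in\mathcal A$. (It is known that then each $x_g$ is strictly positive, lies in the centralizer of $\varphi$, and the $x_g$ commute with each other.) Let $(\mathcal H,\pi,\Phi)$ be the GNS (cyclic) representation of $(\mathcal A,\varphi)$. The formula $U_g\pi(a)\Phi=\pi(g(a)x_{g^{-1}}^{1/2})\Phi$ $(a\in\mathcal A)$ defines a unitary representation $g\mapsto U_g$ of $G$ on $\mathcal H$. On $\mathfrak A=\pi(\mathcal A)''$ put $u_g(x)=U_g x U_g^*$; these are $*$-automorphisms of $\mathfrak A$ with $u_g(\pi(a))=\pi(g(a))$. Here $dg$ is the normalized Haar measure on $G$. Put $P_G:=\int_G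 U_g\,dg$ and $\Phi_G:=P_G\Phi$ (which is nonzero), and $\psi_G(x):=\|\Phi_G\|^{-2}\langle\Phi_G,x\Phi_G\rangle$ for $x\in\mathfrak A$. Umegaki conditional expectation $E:(\mathfrak A,\psi)\to\mathfrak B$ onto a von Neumann subalgebra $\mathfrak B$: a normal, contractive, positive projection of $\mathfrak A$ onto $\mathfrak B$ such that (i) $E(yxy')=yE(x)y'$ for all $x\in\mathfrak A$, $y,y'\in\mathfrak B$, and (ii) $\psi\circ E=\psi$. *)

(* Defs.v *)
From HB Require Import structures.
From mathcomp Require Import all_boot all_order all_algebra.
From mathcomp Require Import complex.
From mathcomp Require Import all_classical all_reals all_analysis.

Set Implicit Arguments.
Unset Strict Implicit.
Unset Printing Implicit Defensive.

Import Order.TTheory GRing.Theory Num.Theory numFieldNormedType.Exports.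

Local Open Scope classical_set_scope.
Local Open Scope ring_scope.

Declare Scope cstar_scope.
Delimit Scope cstar_scope with cstar.
Local Open Scope cstar_scope.

Reserved Notation "a ** b" (at level 40, left associativity).
Reserved Notation "⟨ u , v ⟩" (at level 0, format "⟨ u ,  v ⟩").

HB.mixin Record isTopologicalGroup G of PointedTopological G & Group G := {
  mulg_continuous : continuous (fun p : G * G => (p.1 * p.2)%g);
  invg_continuous : continuous (fun g : G => (g^-1)%g)
}.

#[short(type="topGroupType")]
HB.structure Definition TopologicalGroup :=
  {G of PointedTopological G & Group G & isTopologicalGroup G}.

Notation borel G := (g_sigma_algebraType (@open G)).

(* On a compact Hausdorff space, outer regularity of a finite Borel measure
   gives inner regularity by compact sets as well, by complementation. *)
Definition normalized_haar (R : realType) (G : topGroupType)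
    (mu : {measure set (borel G) -> \bar R}) : Prop :=
  [/\ mu setT = 1%E,
      forall (g : G) (B : set (borel G)), measurable B ->
        mu [set (g * h)%g | h in B] = mu B &
      forall B : set (borel G), measurable B ->
        mu B = ereal_inf [set mu V | V in [set V | @open G V /\ B `<=` V]]].

Definition cintegrable (R : realType) d (T : measurableType d)
    (mu : {measure set T -> \bar R}) (f : T -> R[i]) : Prop :=
  mu.-integrable setT (fun t => (complex.Re (f t))%:E) /\
  mu.-integrable setT (fun t => (complex.Im (f t))%:E).

Definition cintegral (R : realType) d (T : measurableType d)
    (mu : {measure set T -> \bar R}) (f : T -> R[i]) : R[i] :=
  Complex (Rintegral mu setT (fun t => complex.Re (f t)))
          (Rintegral mu setT (fun t => complex.Im (f t))).

(* Supremum of the norm over the closed unit ball. Norms over [R[i]] take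
   values in [R[i]]; they are real, so [Re] loses nothing. The supremum of an
   unbounded set is 0, so this is used for bounded maps only, or in
   [opnorm f = 1], which forces [f] to be bounded. *)
Definition opnorm (R : realType) (V W : normedModType R[i]) (f : V -> W) : R :=
  sup [set complex.Re `|f v| | v in [set v : V | `|v| <= 1]].

(* No unit is assumed. *)
HB.mixin Record isCStarAlgebra (R : realType) A
    of CompleteNormedModule R[i] A := {
  cmul : A -> A -> A;
  cstar : A -> A;
  cmulA : associative cmul;
  cmulDl : left_distributive cmul +%R;
  cmulDr : right_distributive cmul +%R;
  cmulZl : forall (k : R[i]) (a b : A), cmul (k *: a) b = k *: cmul a b;
  cmulZr : forall (k : R[i]) (a b : A), cmul a (k *: b) = k *: cmul a b;
  cmul_norm : forall a b : A, `|cmul a b| <= `|a| * `|b|;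
  cstarK : involutive cstar;
  cstarD : forall a b : A, cstar (a + b) = cstar a + cstar b;
  cstarZ : forall (k : R[i]) (a : A), cstar (k *: a) = k^* *: cstar a;
  cstarM : forall a b : A, cstar (cmul a b) = cmul (cstar b) (cstar a);
  cstar_norm : forall a : A, `|cmul (cstar a) a| = `|a| ^+ 2
}.

#[short(type="cstarAlgType")]
HB.structure Definition CStarAlgebra (R : realType) :=
  {A of CompleteNormedModule R[i] A & isCStarAlgebra R A}.

Notation "a ** b" := (cmul a b) : cstar_scope.

Section CStarAlgebraDefs.
Variables (R : realType) (A : cstarAlgType R).
Implicit Types (a b s : A) (phi : A -> R[i]).

Definition cpositive a : Prop := exists b, a = cstar b ** b.

(* The positive square root (unique when it exists); 0 if [a] is not
   positive. *)
Definition csqrt a : A := xget 0 [set s | cpositive s /\ s ** s = a].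

Definition star_automorphism (f : A -> A) : Prop :=
  [/\ linear f, forall a b, f (a ** b) = f a ** f b,
      forall a, f (cstar a) = cstar (f a) & bijective f].

Definition is_state phi : Prop :=
  [/\ scalar phi, forall a, 0 <= phi (cstar a ** a) &
      opnorm (phi : A -> R[i]^o) = 1].

Definition faithful_state phi : Prop :=
  is_state phi /\ forall a, phi (cstar a ** a) = 0 -> a = 0.

Variable G : topGroupType.
Implicit Types (alpha : G -> A -> A) (x : G -> A).

(* [G] is a group of *-automorphisms: [alpha] identifies it with a subgroup of
   the automorphism group of [A]. *)
Definition automorphism_group alpha : Prop :=
  [/\ forall g, star_automorphism (alpha g),
      forall g h, alpha (g * h)%g = alpha g \o alpha h &
      injective alpha].

(* For faithful [phi], the family [x] is uniquely determined. *)
Definition strongly_quasi_invariant alpha phi x : Prop :=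
  forall g, cstar (x g) = x g /\ forall a, phi (alpha g a) = phi (x g ** a).

End CStarAlgebraDefs.

(* The inner product is linear in its second argument. *)
HB.mixin Record isHilbert (R : realType) H of CompleteNormedModule R[i] H := {
  inner : H -> H -> R[i];
  innerDr : forall u v w : H, inner u (v + w) = inner u v + inner u w;
  innerZr : forall (k : R[i]) (u v : H), inner u (k *: v) = k * inner u v;
  innerC : forall u v : H, inner v u = (inner u v)^*;
  inner_norm : forall u : H, inner u u = `|u| ^+ 2
}.

#[short(type="hilbertType")]
HB.structure Definition Hilbert (R : realType) :=
  {H of CompleteNormedModule R[i] H & isHilbert R H}.

Notation "⟨ u , v ⟩" := (inner u v) : cstar_scope.

Section Operators.
Variables (R : realType) (H : hilbertType R).
Implicit Types (S T : H -> H) (M D : set (H -> H)).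

Definition bounded_op T : Prop := linear T /\ continuous T.

Definition adj T : H -> H :=
  xget (fun=> 0)
    [set S | bounded_op S /\ forall u v, ⟨S u, v⟩ = ⟨u, T v⟩].

Definition self_adjoint T : Prop := bounded_op T /\ adj T = T.

Definition unitary T : Prop :=
  [/\ bounded_op T, adj T \o T = id & T \o adj T = id].

Definition positive_op T : Prop := bounded_op T /\ forall u, 0 <= ⟨u, T u⟩.

Definition op_le S T : Prop := positive_op (T \- S).

Definition commutant M : set (H -> H) :=
  [set T | bounded_op T /\ forall S, M S -> S \o T = T \o S].

Definition bicommutant M : set (H -> H) := commutant (commutant M).

Definition von_neumann_algebra M : Prop :=
  (forall T, M T -> M (adj T)) /\ bicommutant M = M.

Definition is_lub M D T : Prop :=
  [/\ M T, self_adjoint T, forall S, D S -> op_le S T &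
      forall T', M T' -> self_adjoint T' ->
        (forall S, D S -> op_le S T') -> op_le T T'].

Definition directed D : Prop :=
  forall S T, D S -> D T -> exists V, [/\ D V, op_le S V & op_le T V].

(* Preservation of suprema of bounded increasing nets of self-adjoint
   elements, a net being replaced by the directed set of its values. *)
Definition normal_map M N (E : (H -> H) -> (H -> H)) : Prop :=
  forall D T, D !=set0 -> D `<=` M `&` self_adjoint -> directed D ->
    is_lub M D T -> is_lub N (E @` D) (E T).

Record umegaki_expectation M (psi : (H -> H) -> R[i]) N
    (E : (H -> H) -> (H -> H)) : Prop := UmegakiExpectation {
  umegaki_vN : von_neumann_algebra M;
  umegaki_subvN : von_neumann_algebra N /\ N `<=` M;
  umegaki_linear : forall (k : R[i]) S T, M S -> M T ->
    E (fun u => k *: S u + T u) = (fun u => k *: E S u + E T u);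
  umegaki_onto : E @` M = N;
  umegaki_proj : forall T, N T -> E T = T;
  umegaki_pos : forall T, M T -> positive_op T -> positive_op (E T);
  umegaki_contr : forall T, M T -> opnorm (E T) <= opnorm T;
  umegaki_normal : normal_map M N E;
  umegaki_bimod : forall T S S', M T -> N S -> N S' ->
    E (S \o T \o S') = S \o E T \o S';
  umegaki_inv : forall T, M T -> psi (E T) = psi T
}.

Section OperatorIntegral.
Variables (d : measure_display) (X : measurableType d).
Variable mu : {measure set X -> \bar R}.

(* Weak operator integral: [⟨u, T v⟩ = ∫ ⟨u, F x v⟩ dmu(x)]. *)
Definition is_op_integral (F : X -> H -> H) T : Prop :=
  bounded_op T /\
  forall u v, cintegrable mu (fun x => ⟨u, F x v⟩) /\
              ⟨u, T v⟩ = cintegral mu (fun x => ⟨u, F x v⟩).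

Definition op_integral (F : X -> H -> H) : H -> H :=
  xget (fun=> 0) [set T | is_op_integral F T].

End OperatorIntegral.
End Operators.

Section GNS.
Variables (R : realType) (A : cstarAlgType R) (H : hilbertType R).
Implicit Types (pi : A -> H -> H).

Definition star_representation pi : Prop :=
  [/\ forall a, bounded_op (pi a),
      forall (k : R[i]) a b, pi (k *: a + b) = (fun u => k *: pi a u + pi b u),
      forall a b, pi (a ** b) = pi a \o pi b &
      forall a, pi (cstar a) = adj (pi a)].

Definition gns_representation (phi : A -> R[i]) pi (Phi : H) : Prop :=
  [/\ star_representation pi, dense (range (fun a => pi a Phi)) &
      forall a, phi a = ⟨Phi, pi a Phi⟩].

Definition gns_vN pi : set (H -> H) := bicommutant (range pi).

Variables (G : topGroupType) (mu : {measure set (borel G) -> \bar R}).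
Implicit Types (U : G -> H -> H) (Phi : H).

Definition unitary_representation U : Prop :=
  (forall g, unitary (U g)) /\ forall g h, U (g * h)%g = U g \o U h.

Definition strongly_continuous U : Prop :=
  forall v : H, continuous (fun g => U g v).

Definition conj_action U (g : G) (T : H -> H) : H -> H :=
  U g \o T \o adj (U g).

Definition P_G U : H -> H := op_integral mu (U : borel G -> H -> H).

Definition Phi_G U Phi : H := P_G U Phi.

Definition psi_G U Phi (T : H -> H) : R[i] :=
  (`|Phi_G U Phi| ^- 2) * ⟨Phi_G U Phi, T (Phi_G U Phi)⟩.

Definition fix_algebra pi U : set (H -> H) :=
  [set T | gns_vN pi T /\ forall g, conj_action U g T = T].

Definition E_G U (T : H -> H) : H -> H :=
  op_integral mu ((fun g => conj_action U g T) : borel G -> H -> H).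

End GNS.

(* Main.v *)
From HB Require Import structures.
From mathcomp Require Import all_boot all_order all_algebra.
From mathcomp Require Import complex ring lra.
From mathcomp Require Import all_classical all_reals all_analysis.
From mathcomp Require Import measurable_realfun.
Require Import Defs.

Set Implicit Arguments.
Unset Strict Implicit.
Unset Printing Implicit Defensive.

Import Order.TTheory GRing.Theory Num.Theory numFieldNormedType.Exports.

Local Open Scope classical_set_scope.
Local Open Scope ring_scope.
Local Open Scope cstar_scope.

(** Everything rests on the real inner product [rdot u v], the real part of the
    complex one. It determines the complex inner product, because
    [rdot (i u) v] is the imaginary part, and so all integrals, limits and
    inequalities can be taken in the real field.

    By the Riesz theorem, a bounded form on [H] comes from a bounded operator
    ([form_operator]). This gives adjoints; it gives the weak integral of a
    bounded family [F] of operators with continuous coefficients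
    ([is_op_integral_op_integral]); and it gives limits of increasing nets.
    Applied to [conj_action U g T], whose coefficients are
    [rdot (U g^-1 u) (T (U g^-1 v))], it defines the average [E T] by
    [rdot u (E T v) = \int rdot (U g^-1 u) (T (U g^-1 v)) dg] ([rdot_E_G]).

    The algebraic properties of [E] follow from this formula. The formula for
    [U] on the dense set of vectors [pi a Phi] says that [U g] intertwines
    [pi a] and [pi (alpha g a)] ([gns_covariant]), so [U] normalises the
    commutant of [range pi] and hence its bicommutant, the algebra [M] generated
    by [pi] ([conj_action_gns_vN]). An operator commuting with all the integrands
    commutes with the integral, so [E T] is in [M]. Left invariance of the Haar
    measure makes [E T] fixed by the action ([conj_action_E_G]) and [P_G U v]
    fixed by [U] ([repr_P_G]); the latter makes the integrand of
    [⟨Phi_G, E T Phi_G⟩] constant, whence invariance of the state ([psi_G_E_G]).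
    The fixed-point algebra is the commutant of a set closed under adjoints,
    made of the commutant of [range pi] and the operators [U g]
    ([fix_algebraE]), so it is a von Neumann algebra.

    Normality is the analytic point. If [T] is the supremum in [M] of an
    increasing net [D] then [rdot v (T v)] is, for every [v], the supremum of
    the numbers [rdot v (S v)], [S] in [D] ([lub_pointwise]). Hence the functions
    [g |-> rdot (U g^-1 v) ((T - S) (U g^-1 v))] are continuous on the compact
    group [G], decrease along the net, and tend to 0 pointwise; by Dini's theorem
    they do so uniformly, and integration gives [rdot v (E T v)] as the supremum
    of the [rdot v (E S v)] ([E_G_normal]). *)

(** * The real inner product of a complex Hilbert space *)

Section RealInnerProduct.
Variables (R : realType) (H : hilbertType R).
Implicit Types (u v w : H) (t : R).

Definition imag_unit : R[i] := Complex 0 1.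
Definition rnorm v : R := complex.Re `|v|.
Definition rdot u v : R := complex.Re ⟨u, v⟩.
Definition rscale t v : H := t%:C%C *: v.

Lemma rnormE v : `|v| = ((rnorm v)%:C)%C.
Proof. by rewrite /rnorm RRe_real// normr_real. Qed.

Lemma rnorm_ge0 v : 0 <= rnorm v.
Proof. by have := normr_ge0 v; rewrite rnormE lecE => /andP[_]. Qed.

Lemma rnorm_eq0 v : rnorm v = 0 -> v = 0.
Proof. by move=> v0; apply/normr0_eq0; rewrite rnormE v0. Qed.

Lemma rnorm0 : rnorm 0 = 0.
Proof. by rewrite /rnorm normr0. Qed.

Lemma ler_rnormD u v : rnorm (u + v) <= rnorm u + rnorm v.
Proof. by have := ler_normD u v; rewrite !rnormE -rmorphD lecR. Qed.

Lemma ler_rnormB u v : `|rnorm u - rnorm v| <= rnorm (u - v).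
Proof.
have N w : rnorm (- w) = rnorm w by rewrite /rnorm normrN.
rewrite ler_norml; apply/andP; split.
  by have := ler_rnormD u (v - u); rewrite addrC subrK -opprB N; lra.
by have := ler_rnormD (u - v) v; rewrite subrK; lra.
Qed.

Lemma rnormZ t v : rnorm (rscale t v) = `|t| * rnorm v.
Proof.
rewrite /rscale {1}/rnorm normrZ rnormE.
suff -> : `|(t%:C)%C| = (`|t|%:C)%C by rewrite -rmorphM.
by rewrite normc_def /= expr0n addr0 sqrtr_sqr.
Qed.

Lemma rscaleN1 v : rscale (-1) v = - v.
Proof. by rewrite /rscale rmorphN scaleNr scale1r. Qed.

Lemma scale_complexE (k : R[i]) v :
  k *: v = rscale (complex.Re k) v + imag_unit *: rscale (complex.Im k) v.
Proof. by rewrite /rscale scalerA -scalerDl [in LHS](complexE k). Qed.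

Lemma Re_conj (z : R[i]) : complex.Re z^* = complex.Re z.
Proof. by case: z. Qed.

Lemma rdotC u v : rdot u v = rdot v u.
Proof. by rewrite /rdot innerC Re_conj. Qed.

Lemma rdotDr u v w : rdot u (v + w) = rdot u v + rdot u w.
Proof. by rewrite /rdot innerDr; case: inner; case: inner. Qed.

Lemma rdotZr t u v : rdot u (rscale t v) = t * rdot u v.
Proof. by rewrite /rdot innerZr; case: inner => a b /=; ring. Qed.

Lemma rdotDl u v w : rdot (u + v) w = rdot u w + rdot v w.
Proof. by rewrite ![rdot _ w]rdotC rdotDr. Qed.

Lemma rdotZl t u v : rdot (rscale t u) v = t * rdot u v.
Proof. by rewrite ![rdot _ v]rdotC rdotZr. Qed.

Lemma rdotNr u v : rdot u (- v) = - rdot u v.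
Proof. by rewrite -rscaleN1 rdotZr mulN1r. Qed.

Lemma rdotNl u v : rdot (- u) v = - rdot u v.
Proof. by rewrite -rscaleN1 rdotZl mulN1r. Qed.

Lemma rdotBr u v w : rdot u (v - w) = rdot u v - rdot u w.
Proof. by rewrite rdotDr rdotNr. Qed.

Lemma rdotBl u v w : rdot (u - v) w = rdot u w - rdot v w.
Proof. by rewrite rdotDl rdotNl. Qed.

Lemma rdot0r u : rdot u 0 = 0.
Proof. by have := rdotBr u 0 0; rewrite !subrr. Qed.

Lemma innerZl (k : R[i]) u v : ⟨k *: u, v⟩ = k^* * ⟨u, v⟩.
Proof. by rewrite (innerC v (k *: u)) innerZr (innerC v u) rmorphM. Qed.

Lemma rdot_imag u v : rdot (imag_unit *: u) v = complex.Im ⟨u, v⟩.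
Proof. by rewrite /rdot innerZl; case: inner => a b /=; ring. Qed.

Lemma rdot_imag2 u v : rdot (imag_unit *: u) (imag_unit *: v) = rdot u v.
Proof. by rewrite rdot_imag innerZr /rdot; case: inner => a b /=; ring. Qed.

Lemma rdot_inner_eq u v u' v' : rdot u v = rdot u' v' ->
  rdot (imag_unit *: u) v = rdot (imag_unit *: u') v' -> ⟨u, v⟩ = ⟨u', v'⟩.
Proof.
rewrite !rdot_imag /rdot.
by case: (inner u v) => a b; case: (inner u' v') => c d /= -> ->.
Qed.

Lemma rdotvv v : rdot v v = rnorm v ^+ 2.
Proof. by rewrite /rdot inner_norm rnormE -rmorphXn. Qed.

(** Equations between vectors, and so between operators, are tested by real
    parts alone. *)
Lemma rdot_inj v w : (forall u, rdot u v = rdot u w) -> v = w.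
Proof.
move=> E; apply/subr0_eq/rnorm_eq0/eqP.
by rewrite -sqrf_eq0 -rdotvv rdotBr E subrr.
Qed.

(** Polarisation, from which the continuity of the inner product follows from
    that of the norm. *)
Lemma rdot_polar u v :
  rdot u v = (rnorm (u + v) ^+ 2 - rnorm (u - v) ^+ 2) / 4.
Proof.
rewrite -!rdotvv !(rdotDl, rdotDr, rdotNl, rdotNr) [rdot v u]rdotC; lra.
Qed.

Lemma parallelogram u v : rnorm (u + v) ^+ 2 + rnorm (u - v) ^+ 2 =
  2 * rnorm u ^+ 2 + 2 * rnorm v ^+ 2.
Proof.
rewrite -!rdotvv !(rdotDl, rdotDr, rdotNl, rdotNr) [rdot v u]rdotC; lra.
Qed.

Lemma CauchySchwarz u v : `|rdot u v| <= rnorm u * rnorm v.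
Proof.
have [v0|v0] := eqVneq (rnorm v) 0.
  by rewrite (rnorm_eq0 v0) rdot0r normr0 rnorm0 mulr0.
have vp : 0 < rnorm v ^+ 2 by rewrite exprn_gt0// lt_neqAle eq_sym v0 rnorm_ge0.
have : 0 <= rnorm (rscale (rnorm v ^+ 2) u - rscale (rdot u v) v) ^+ 2.
  by rewrite sqr_ge0.
rewrite -rdotvv !(rdotBl, rdotBr, rdotZl, rdotZr) [rdot v u]rdotC !rdotvv => E.
rewrite -ler_sqr ?nnegrE// ?mulr_ge0 ?rnorm_ge0// -normrX ger0_norm ?sqr_ge0//.
rewrite -subr_ge0 -(pmulr_rge0 _ vp) exprMn; apply: le_trans E _.
by rewrite le_eqVlt; apply/orP; left; apply/eqP; ring.
Qed.

Lemma rnorm_continuous : continuous rnorm.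
Proof.
move=> v; apply/cvgrPdist_le => e e0.
have e0' : (0 : R[i]) < (e%:C)%C by rewrite ltcR.
have /cvgrPdist_le/(_ _ e0') : id @ nbhs v --> v by exact: cvg_id.
apply: filterS => w; rewrite rnormE lecR; apply: le_trans; exact: ler_rnormB.
Qed.

(** Convergence along any filter is stated for two moving arguments: coefficients
    [g |-> rdot (U g^-1 u) (T (U g^-1 v))] move both. *)
Lemma rdot_cvg (T : Type) (F : set_system T) (FF : Filter F)
  (f g : T -> H) u v :
  f @ F --> u -> g @ F --> v -> (fun i => rdot (f i) (g i)) @ F --> rdot u v.
Proof.
move=> fu gv.
rewrite rdot_polar (_ : (fun i => _) = (fun i =>
  (rnorm (f i + g i) ^+ 2 - rnorm (f i - g i) ^+ 2) / 4)); last first.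
  by apply/funext => i; rewrite rdot_polar.
have N : forall (h : T -> H) w, h @ F --> w ->
    (fun i => rnorm (h i) ^+ 2) @ F --> rnorm w ^+ 2.
  move=> h w hw; rewrite expr2; under eq_fun do rewrite expr2.
  have hn : (fun i => rnorm (h i)) @ F --> rnorm w.
    by apply: (cvg_comp h rnorm hw); exact: rnorm_continuous.
  exact: cvgM.
apply: cvgMr_tmp; apply: cvgB; apply: N; [exact: cvgD|exact: cvgB].
Qed.

End RealInnerProduct.

(** * Bounded operators from real bilinear forms *)

Section Riesz.
Variables (R : realType) (H : hilbertType R).
Implicit Types (u v w : H) (t : R).

Lemma bounded_opP (T : H -> H) : bounded_op T <->
  linear T /\ exists2 C : R, 0 <= C & forall v, rnorm (T v) <= C * rnorm v.
Proof.
split=> [[lT cT]|[lT [C C0 TC]]]; split => //.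
  pose LT := GRing.isLinear.Build _ _ _ _ T lT.
  pose f : {linear H -> H} := HB.pack T LT.
  have /linear_boundedP : bounded_near f (nbhs (0 : H)).
    by apply/linear_bounded_continuous.
  move=> /pinfty_ex_gt0[r r0 fr]; exists (complex.Re r).
    by move: r0; rewrite ltcE => /andP[_ /ltW].
  move=> v; have := fr v.
  rewrite !rnormE -[r in X in X -> _]RRe_real ?gtr0_real//.
  by rewrite -rmorphM lecR.
move=> v; apply/cvgrPdist_le => e e0.
have er : e = ((complex.Re e)%:C)%C by rewrite RRe_real// gtr0_real.
move: e0; rewrite er ltcR; set r := complex.Re e => r0.
have r1 : (0 : R[i]) < ((r / (C + 1))%:C)%C.
  by rewrite ltcR divr_gt0// ltr_wpDl.
have /cvgrPdist_le/(_ _ r1) : id @ nbhs v --> v by exact: cvg_id.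
apply: filterS => w; rewrite !rnormE !lecR => vw.
have -> : T v - T w = T (v - w).
  by rewrite addrC -scaleN1r -lT scaleN1r addrC.
apply: le_trans (TC _) _; apply: (@le_trans _ _ (C * (r / (C + 1)))).
  exact: ler_wpM2l.
rewrite mulrCA ler_piMr ?(ltW r0)// ler_pdivrMr ?mul1r ?lerDl//.
by rewrite ltr_wpDl.
Qed.

Lemma bounded_additive_continuous (f : H -> R) C :
  (forall u v, f (u - v) = f u - f v) -> (forall v, `|f v| <= C * rnorm v) ->
  continuous f.
Proof.
move=> fB fC v; apply/cvgrPdist_le => r r0.
have C1 : 0 < `|C| + 1 by rewrite ltr_wpDl.
have r1 : (0 : R[i]) < ((r / (`|C| + 1))%:C)%C.
  by rewrite ltcR divr_gt0.
have /cvgrPdist_le/(_ _ r1) : id @ nbhs v --> v by exact: cvg_id.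
apply: filterS => w; rewrite !rnormE !lecR => vw; rewrite -fB.
apply: le_trans (fC _) _; apply: (@le_trans _ _ (`|C| * (r / (`|C| + 1)))).
  apply: le_trans (ler_wpM2l _ vw) => //.
  by rewrite ler_wpM2r ?rnorm_ge0// ler_norm.
rewrite mulrCA ler_piMr ?(ltW r0)// ler_pdivrMr ?mul1r ?lerDl//.
Qed.

(** The representing vector is the minimiser of [J v = |v|^2 - 2 f v]. As [f] is
    linear, it cancels in the parallelogram law for [J], which therefore forces
    minimising sequences to be Cauchy; the first variation of [J] at the
    minimiser is the claim. *)
Lemma riesz (f : H -> R) C : 0 <= C ->
  (forall u v, f (u + v) = f u + f v) ->
  (forall t v, f (rscale t v) = t * f v) ->
  (forall v, `|f v| <= C * rnorm v) ->
  exists w, forall v, rdot w v = f v.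
Proof.
move=> C0 fD fZ fC.
have fB u v : f (u - v) = f u - f v by rewrite fD -rscaleN1 fZ mulN1r.
pose J v := rnorm v ^+ 2 - 2 * f v.
have J_ge v : - C ^+ 2 <= J v.
  have /ler_normlW f1 := fC v; rewrite /J.
  have : 0 <= (rnorm v - C) ^+ 2 by rewrite sqr_ge0.
  by rewrite sqrrB; lra.
have lbJ : has_inf (range J).
  split; first by exists (J 0), 0.
  by exists (- C ^+ 2) => _ [v _ <-].
pose d := inf (range J).
have d_le v : d <= J v by apply: (ge_inf lbJ.2); exists v.
(* The filter of approximate minimisers replaces a minimising sequence. *)
pose F := filter_from [set e : R | 0 < e] (fun e => [set v : H | J v < d + e]).
have FF : ProperFilter F.
  apply: filter_from_proper; last first.
    move=> e /= e0; have [_ [v _ <-] Jv] := inf_adherent e0 lbJ.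
    by exists v.
  apply: filter_from_filter; first by exists 1 => /=.
  move=> a b /= a0 b0; exists (Num.min a b); first by rewrite /= lt_min a0 b0.
  move=> v /= vab; split; apply: (lt_le_trans vab); rewrite lerD2l ge_min.
    by rewrite lexx.
  by rewrite lexx orbT.
(* The parallelogram law at the midpoint makes minimising sequences Cauchy. *)
have mid u v : rnorm (u - v) ^+ 2 <= 2 * (J u + J v - 2 * d).
  have := d_le (rscale 2^-1 (u + v)).
  rewrite {1}/J rnormZ fZ fD exprMn ger0_norm ?invr_ge0//.
  have := parallelogram u v; rewrite /J.
  have -> : (2^-1 : R) ^+ 2 = 4^-1 by rewrite exprVn; congr _^-1; ring.
  lra.
have cF : cauchy F.
  apply/cauchy_ballP => e e0.
  have er : e = ((complex.Re e)%:C)%C by rewrite RRe_real// gtr0_real.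
  move: e0; rewrite er ltcR; set r := complex.Re e => r0.
  pose B := [set v | J v < d + r ^+ 2 / 4].
  have FB : F B by exists (r ^+ 2 / 4) => //=; rewrite divr_gt0// exprn_gt0.
  exists (B, B) => // -[u v] [/= Bu Bv].
  rewrite -ball_normE /ball_ /= rnormE ltcR -ltr_sqr ?nnegrE ?rnorm_ge0 ?ltW//.
  apply: le_lt_trans (mid _ _) _; move: Bu Bv; rewrite /B /=; lra.
have Fw : F --> lim F by exact: cauchy_cvg.
set w := lim F in Fw.
have cf : continuous f by exact: bounded_additive_continuous fC.
have JFw : J @ F --> J w.
  apply: cvgB.
    rewrite expr2; under eq_fun do rewrite expr2.
    have nF : @rnorm R H @ F --> rnorm w.
      by apply: (cvg_comp id (@rnorm R H) Fw); exact: rnorm_continuous.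
    exact: cvgM.
  by apply: cvgMl_tmp; apply: (cvg_comp id f Fw); exact: cf.
have JFd : J @ F --> d.
  apply/cvgrPdist_lt => e e0; exists e => // v /= Jv.
  by rewrite distrC ger0_norm ?subr_ge0 ?d_le// ltrBlDl.
have Jw : J w = d by exact: (cvg_unique _ JFw JFd).
exists w => v; apply/eqP; rewrite -subr_eq0.
set b := rdot w v - f v; set a := rnorm v ^+ 2.
have a0 : 0 <= a by rewrite sqr_ge0.
have var t : 0 <= t ^+ 2 * a + 2 * t * b.
  have := d_le (w + rscale t v); rewrite -Jw /J -!rdotvv fD fZ.
  rewrite !(rdotDl, rdotDr, rdotZl, rdotZr) [rdot v w]rdotC !rdotvv /b /a; lra.
(* A nearly optimal step; [a + 1] rather than [a] avoids the case [v = 0]. *)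
have := var (- b / (a + 1)).
have a1 : 0 < a + 1 by lra.
have -> : (- b / (a + 1)) ^+ 2 * a + 2 * (- b / (a + 1)) * b =
    - (b ^+ 2 * ((a + 2) / (a + 1) ^+ 2)) by field; lra.
have ap : 0 < (a + 2) / (a + 1) ^+ 2 by rewrite divr_gt0 ?exprn_gt0//; lra.
rewrite oppr_ge0 pmulr_lle0// => b0.
by rewrite -sqrf_eq0 eq_le b0 sqr_ge0.
Qed.

Lemma linear_real_imag (T : H -> H) : (forall u v, T (u + v) = T u + T v) ->
  (forall t v, T (rscale t v) = rscale t (T v)) ->
  (forall v, T (imag_unit R *: v) = imag_unit R *: T v) -> linear T.
Proof.
move=> TD TZ Ti k u v; rewrite TD; congr (_ + _).
by rewrite (scale_complexE k u) (scale_complexE k (T u)) TD Ti !TZ.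
Qed.

(** Invariance of [s] under multiplication of both arguments by [i] is what
    makes the real-linear operator provided by [riesz] complex linear. *)
Lemma form_operator (s : H -> H -> R) C : 0 <= C ->
  (forall u u' v, s (u + u') v = s u v + s u' v) ->
  (forall t u v, s (rscale t u) v = t * s u v) ->
  (forall u v v', s u (v + v') = s u v + s u v') ->
  (forall t u v, s u (rscale t v) = t * s u v) ->
  (forall u v, s (imag_unit R *: u) (imag_unit R *: v) = s u v) ->
  (forall u v, `|s u v| <= C * rnorm u * rnorm v) ->
  exists2 T, bounded_op T & forall u v, rdot u (T v) = s u v.
Proof.
move=> C0 sDl sZl sDr sZr si sC.
have /choice[T TE] : forall v, exists w, forall u, rdot w u = s u v.
  move=> v; apply: (@riesz (s ^~ v) (C * rnorm v)) => //.
    by rewrite mulr_ge0// rnorm_ge0.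
  by move=> u; rewrite mulrAC; exact: sC.
have {}TE u v : rdot u (T v) = s u v by rewrite rdotC TE.
exists T => //; apply/bounded_opP; split.
  apply: linear_real_imag => [u v|t v|v]; apply: rdot_inj => w.
  - by rewrite rdotDr !TE sDr.
  - by rewrite rdotZr !TE sZr.
  - (* [w = i (- i w)], and [s] is invariant under [(i, i)]. *)
    have -> : w = imag_unit R *: (- (imag_unit R *: w)).
      rewrite scalerN scalerA (_ : imag_unit R * imag_unit R = -1).
        by rewrite scaleN1r opprK.
      by rewrite /imag_unit; apply/eqP; rewrite eq_complex /=; apply/andP;
        split; apply/eqP; ring.
    by rewrite rdot_imag2 !TE si.
exists C => // v; have [->|Tv0] := eqVneq (rnorm (T v)) 0.
  by rewrite mulr_ge0// rnorm_ge0.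
have Tvp : 0 < rnorm (T v) by rewrite lt_neqAle eq_sym Tv0 rnorm_ge0.
rewrite -(ler_pM2l Tvp) -expr2 -rdotvv TE mulrA [_ * C]mulrC.
exact: le_trans (ler_norm _) (sC _ _).
Qed.

End Riesz.

(** * Adjoints and commutants *)

Section Adjoint.
Variables (R : realType) (H : hilbertType R).
Implicit Types (u v w : H) (S T : H -> H) (M : set (H -> H)).

Lemma bounded_opD T u v : bounded_op T -> T (u + v) = T u + T v.
Proof. by case=> lT _; have := lT 1 u v; rewrite !scale1r. Qed.

Lemma bounded_op0 T : bounded_op T -> T 0 = 0.
Proof.
move=> bT; have := bounded_opD 0 0 bT; rewrite addr0 => /eqP.
by rewrite -{1}[T 0]addr0 (inj_eq (addrI _)) eq_sym => /eqP.
Qed.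

Lemma bounded_opZ T (k : R[i]) v : bounded_op T -> T (k *: v) = k *: T v.
Proof.
move=> bT; case: (bT) => lT _; have := lT k v 0.
by rewrite !addr0 (bounded_op0 bT) addr0.
Qed.

Lemma bounded_opB T u v : bounded_op T -> T (u - v) = T u - T v.
Proof. by move=> bT; rewrite bounded_opD// -scaleN1r bounded_opZ// scaleN1r. Qed.

Lemma bounded_op_comp S T : bounded_op S -> bounded_op T ->
  bounded_op (S \o T).
Proof.
move=> [lS cS] [lT cT]; split; first by move=> k u v /=; rewrite lT lS.
by move=> v; apply: continuous_comp; [exact: cT|exact: cS].
Qed.

Lemma bounded_op_lin (k : R[i]) S T : bounded_op S -> bounded_op T ->
  bounded_op (fun v => k *: S v + T v).
Proof.
move=> [lS cS] [lT cT]; split.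
  move=> l u v; rewrite lS lT !scalerDr !scalerA [k * l]mulrC -!addrA.
  by congr (_ + _); rewrite addrCA.
move=> v; apply: cvgD; last exact: cT.
by apply: cvgZl_tmp; exact: cS.
Qed.

Lemma bounded_op_sub S T : bounded_op S -> bounded_op T -> bounded_op (S \- T).
Proof.
move=> bS bT; rewrite (_ : S \- T = fun v => -1 *: T v + S v).
  exact: bounded_op_lin.
by apply/funext => v; rewrite scaleN1r addrC.
Qed.

(** [form_operator] applied to [fun u v => rdot (T u) v] gives an operator with
    the property required of the adjoint. *)
Lemma adj_prop T : bounded_op T ->
  bounded_op (adj T) /\ forall u v, ⟨adj T u, v⟩ = ⟨u, T v⟩.
Proof.
move=> bT.
suff ex : exists S, bounded_op S /\ forall u v, ⟨S u, v⟩ = ⟨u, T v⟩.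
  exact: (@xgetPex _ (fun=> 0 : H) [set S | bounded_op S /\
    forall u v, ⟨S u, v⟩ = ⟨u, T v⟩] ex).
have [_ [C C0 TC]] := (bounded_opP T).1 bT.
have [||||||S bS SE] := @form_operator _ _ (fun u v => rdot (T u) v) C C0.
- by move=> u u' v; rewrite bounded_opD// rdotDl.
- by move=> t u v; rewrite /rscale bounded_opZ// rdotZl.
- by move=> u v v'; rewrite rdotDr.
- by move=> t u v; rewrite rdotZr.
- by move=> u v; rewrite bounded_opZ// rdot_imag2.
- move=> u v; apply: le_trans (CauchySchwarz _ _) _.
  by rewrite ler_wpM2r ?rnorm_ge0.
exists S; split => // u v; apply: rdot_inner_eq.
  by rewrite rdotC SE rdotC.
by rewrite -bounded_opZ// rdotC SE rdotC.
Qed.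

Lemma bounded_adj T : bounded_op T -> bounded_op (adj T).
Proof. by move=> /adj_prop[]. Qed.

Lemma inner_adjl T u v : bounded_op T -> ⟨adj T u, v⟩ = ⟨u, T v⟩.
Proof. by move=> /adj_prop[]. Qed.

Lemma rdot_adjl T u v : bounded_op T -> rdot (adj T u) v = rdot u (T v).
Proof. by move=> bT; rewrite /rdot inner_adjl. Qed.

Lemma rdot_adjr T u v : bounded_op T -> rdot u (adj T v) = rdot (T u) v.
Proof. by move=> bT; rewrite rdotC rdot_adjl// rdotC. Qed.

Lemma op_rdot_ext S T : (forall u v, rdot u (S v) = rdot u (T v)) -> S = T.
Proof. by move=> E; apply/funext => v; exact: rdot_inj. Qed.

Lemma adj_uniq S T : bounded_op T ->
  (forall u v, rdot u (S v) = rdot (T u) v) -> adj T = S.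
Proof. by move=> bT E; apply: op_rdot_ext => u v; rewrite rdot_adjr. Qed.

Lemma adjK T : bounded_op T -> adj (adj T) = T.
Proof.
by move=> bT; apply: adj_uniq (bounded_adj bT) _ => u v; rewrite rdot_adjl.
Qed.

Lemma adj_comp S T : bounded_op S -> bounded_op T ->
  adj (S \o T) = adj T \o adj S.
Proof.
move=> bS bT; apply: adj_uniq; first exact: bounded_op_comp.
by move=> u v /=; rewrite !rdot_adjr.
Qed.

Lemma self_adjointP T : self_adjoint T <->
  bounded_op T /\ forall u v, rdot u (T v) = rdot (T u) v.
Proof.
split=> [[bT aT]|[bT sT]]; split => //; last exact: adj_uniq.
by move=> u v; rewrite -{1}aT rdot_adjr.
Qed.

Lemma self_adjoint_Im T v : self_adjoint T -> complex.Im ⟨v, T v⟩ = 0.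
Proof.
move=> /self_adjointP[bT sT]; have := sT (imag_unit R *: v) v.
rewrite bounded_opZ// [in RHS]rdotC -[in RHS]rdot_imag2 scalerA.
rewrite (_ : imag_unit R * imag_unit R = -1); last first.
  by apply/eqP; rewrite eq_complex /=; apply/andP; split; apply/eqP; ring.
rewrite scaleN1r rdotNr [in RHS]rdot_imag rdot_imag; lra.
Qed.

(** The order on self-adjoint operators is a statement on real quadratic
    forms: their values have no imaginary part. *)
Lemma op_leP S T : self_adjoint S -> self_adjoint T ->
  op_le S T <-> forall v, rdot v (S v) <= rdot v (T v).
Proof.
move=> sS sT; have [bS _] := sS; have [bT _] := sT.
have E v : ⟨v, (T \- S) v⟩ = ⟨v, T v⟩ - ⟨v, S v⟩.
  by rewrite /= innerDr -scaleN1r innerZr mulN1r.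
split=> [[_ pos] v|le]; last first.
  split=> [|v]; first exact: bounded_op_sub.
  rewrite E subr_ge0 lecE !self_adjoint_Im// eqxx /=; exact: le.
by have := pos v; rewrite E subr_ge0 lecE => /andP[_].
Qed.

(** The coefficients of a self-adjoint operator are differences of two values of
    its quadratic form, which is how monotone convergence of forms yields
    convergence of coefficients. *)
Lemma self_adjoint_polar T u v : self_adjoint T -> rdot u (T v) =
  (rdot (u + v) (T (u + v)) - rdot (u - v) (T (u - v))) / 4.
Proof.
move=> /self_adjointP[bT sT].
rewrite bounded_opB// bounded_opD// !(rdotDl, rdotDr, rdotNl, rdotNr).
rewrite [rdot v (T u)]sT [rdot (T v) u]rdotC; lra.
Qed.

Lemma commutant_bounded M T : commutant M T -> bounded_op T.
Proof. by case. Qed.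

Lemma commutant_sub M N : M `<=` N -> commutant N `<=` commutant M.
Proof. by move=> MN T [bT cT]; split => // S /MN/cT. Qed.

Lemma commutant_adj M T : (M `<=` bounded_op (R := R) (H := H)) ->
  (forall S, M S -> M (adj S)) -> commutant M T -> commutant M (adj T).
Proof.
move=> bM aM [bT cT]; split; first exact: bounded_adj.
move=> S MS; have bS := bM _ MS; have bS' := bounded_adj bS.
have /(congr1 (@adj R H)) := cT _ (aM _ MS).
by rewrite (adj_comp bT bS') (adj_comp bS' bT) (adjK bS).
Qed.

Lemma sub_bicommutant M : (M `<=` bounded_op (R := R) (H := H)) ->
  M `<=` bicommutant M.
Proof. by move=> bM T MT; split; [exact: bM|move=> S [_ cS]; rewrite cS]. Qed.

(** Both inclusions come from [sub_bicommutant], for [commutant M] and for [M];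
    in the second case taking commutants reverses the inclusion. *)
Lemma bicommutant_commutant M : (M `<=` bounded_op (R := R) (H := H)) ->
  bicommutant (commutant M) = commutant M.
Proof.
move=> bM; apply/seteqP; split; last first.
  exact/sub_bicommutant/commutant_bounded.
exact/commutant_sub/sub_bicommutant.
Qed.

Lemma commutant_von_neumann M : (M `<=` bounded_op (R := R) (H := H)) ->
  (forall S, M S -> M (adj S)) -> von_neumann_algebra (commutant M).
Proof.
by move=> bM aM; split; [move=> T; exact: commutant_adj|
  exact: bicommutant_commutant].
Qed.

End Adjoint.

(** * Integration of continuous functions against Haar measure *)

Section HaarIntegral.
Variables (R : realType) (G : topGroupType).
Variable mu : {measure set (borel G) -> \bar R}.
Hypotheses (cG : compact [set: G]) (hmu : normalized_haar mu).
Implicit Types (f : G -> R) (g h : G).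

Local Notation "\int f" := (Rintegral mu setT (f : borel G -> R)) (at level 10).

Lemma continuous_measurable_borel (f : G -> R) : continuous f ->
  measurable_fun setT (f : borel G -> R).
Proof.
move=> /continuousP cf; apply: (measurability _ (RGenOpens.measurableE R)).
move=> _ [_ [a [b ->] <-]]; rewrite setTI; apply: sub_sigma_algebra.
exact/cf/interval_open.
Qed.

(** Continuous functions on the compact group are bounded. *)
Lemma continuous_integrable f : continuous f ->
  mu.-integrable setT (fun g : borel G => (f g)%:E).
Proof.
move=> cf; apply: measurable_bounded_integrable => //.
- by have [-> _ _] := hmu; rewrite ltry.
- exact: continuous_measurable_borel.
- have : compact (f @` setT).
    by apply: continuous_compact => //; exact: continuous_subspaceT.
  move/compact_bounded => [M [Mr Mf]]; exists M; split => // x xM g _.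
  by apply: Mf => //; exists g.
Qed.

Lemma haar_int_cst (c : R) : \int (fun=> c) = c.
Proof. by rewrite Rintegral_cst//; have [-> _ _] := hmu; rewrite mulr1. Qed.

Lemma haar_intD f f' : continuous f -> continuous f' ->
  \int (fun g => f g + f' g) = \int f + \int f'.
Proof. by move=> cf cf'; apply: RintegralD => //; exact: continuous_integrable. Qed.

Lemma haar_intZ (c : R) f : continuous f -> \int (fun g => c * f g) = c * \int f.
Proof. by move=> cf; apply: RintegralZl => //; exact: continuous_integrable. Qed.

Lemma haar_int_le f f' : continuous f -> continuous f' ->
  (forall g, f g <= f' g) -> \int f <= \int f'.
Proof.
by move=> cf cf' ff'; apply: le_Rintegral => //; exact: continuous_integrable.
Qed.

Lemma haar_int_norm_le f (c : R) : continuous f ->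
  (forall g, `|f g| <= c) -> `|\int f| <= c.
Proof.
move=> cf fc; rewrite ler_norml.
have cc (k : R) : continuous (fun _ : G => k) by move=> ?; exact: cvg_cst.
have fc' g : - c <= f g <= c by rewrite -ler_norml.
have := haar_int_le (cc (- c)) cf (fun g => proj1 (andP (fc' g))).
have := haar_int_le cf (cc c) (fun g => proj2 (andP (fc' g))).
by rewrite !haar_int_cst => -> ->.
Qed.

Lemma continuous_mulg h : continuous (fun g : G => (h * g)%g).
Proof.
by move=> g; apply: (cvg_comp2 (cvg_cst h) cvg_id (mulg_continuous (h, g))).
Qed.

(** Left translation by [h] pushes the Haar measure to itself: the preimage of
    [B] is the translate of [B] by the inverse of [h]. *)
Lemma haar_int_translate f h : continuous f ->
  \int (fun g => f (h * g)%g) = \int f.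
Proof.
move=> cf; rewrite /Rintegral; congr fine.
pose L : borel G -> borel G := fun g => (h * g)%g.
have mL : measurable_fun setT L.
  apply: (measurability (@open G : set (set (borel G))) erefl) => _ [V oV <-].
  rewrite setTI; apply: sub_sigma_algebra.
  by have /continuousP := @continuous_mulg h; exact.
have := @integral_pushforward _ _ _ _ R L mL mu setT
  (fun g : borel G => (f g)%:E).
rewrite preimage_setT => <-//; last 2 first.
- exact: (measurable_EFinP _ _).2 (continuous_measurable_borel cf).
- have cfL : continuous (fun g => f (h * g)%g).
    by move=> g; exact: (continuous_comp (@continuous_mulg h g) (@cf _)).
  exact: continuous_integrable.
apply: eq_measure_integral => B mB _; rewrite /pushforward.
have [_ inv _] := hmu; rewrite -(inv h^-1%g B mB); congr (mu _).
apply/seteqP; split => [g /= Bg|_ [g Bg <-]]; last by rewrite /= /L mulgA mulgV mul1g.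
by exists (h * g)%g => //; rewrite mulgA mulVg mul1g.
Qed.

End HaarIntegral.

(** * Weak integrals of operators *)

Section OperatorIntegral.
Variables (R : realType) (G : topGroupType) (H : hilbertType R).
Variable mu : {measure set (borel G) -> \bar R}.
Hypotheses (cG : compact [set: G]) (hmu : normalized_haar mu).
Implicit Types (F : G -> H -> H) (u v : H) (g h : G).

Local Notation "\int f" := (Rintegral mu setT (f : borel G -> R)) (at level 10).

Definition bounded_weakly_continuous F : Prop :=
  [/\ forall g, bounded_op (F g),
      exists2 C : R, 0 <= C & forall g v, rnorm (F g v) <= C * rnorm v &
      forall u v, continuous (fun g => rdot u (F g v))].

Lemma op_integral_rdot F (T : H -> H) u v :
  is_op_integral mu (F : borel G -> H -> H) T ->
  rdot u (T v) = \int (fun g => rdot u (F g v)).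
Proof. by case=> _ /(_ u v)[_]; rewrite /rdot => ->. Qed.

(** The integrated coefficients form a bounded form, hence come from an operator;
    the imaginary part of the required identity is its real part at [i u]. *)
Lemma is_op_integral_op_integral F : bounded_weakly_continuous F ->
  is_op_integral mu (F : borel G -> H -> H)
    (op_integral mu (F : borel G -> H -> H)).
Proof.
move=> [bF [C C0 FC] cF].
suff ex : exists T, is_op_integral mu (F : borel G -> H -> H) T.
  exact: (@xgetPex _ (fun=> 0 : H)
    [set T | is_op_integral mu (F : borel G -> H -> H) T] ex).
have [||||||T bT TE] :=
    @form_operator _ H (fun u v => \int (fun g => rdot u (F g v))) C C0.
- move=> u u' v; rewrite -haar_intD//.
  by congr (Rintegral _ _ _); apply/funext => g; rewrite rdotDl.
- move=> t u v; rewrite -haar_intZ//.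
  by congr (Rintegral _ _ _); apply/funext => g; rewrite rdotZl.
- move=> u v v'; rewrite -haar_intD//.
  by congr (Rintegral _ _ _); apply/funext => g; rewrite bounded_opD// rdotDr.
- move=> t u v; rewrite -haar_intZ//.
  congr (Rintegral _ _ _); apply/funext => g.
  by rewrite /rscale bounded_opZ// rdotZr.
- move=> u v; congr (Rintegral _ _ _); apply/funext => g.
  by rewrite bounded_opZ// rdot_imag2.
- move=> u v; apply: haar_int_norm_le => // g.
  apply: le_trans (CauchySchwarz _ _) _.
  by rewrite [C * _]mulrC -mulrA ler_wpM2l ?rnorm_ge0.
exists T; split => // u v; split.
  split; first exact: (continuous_integrable cG hmu (@cF u v)).
  rewrite (_ : (fun _ => _) =
    (fun g : borel G => (rdot (imag_unit R *: u) (F g v))%:E)).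
    exact: (continuous_integrable cG hmu (@cF _ v)).
  by apply/funext => g; rewrite rdot_imag.
apply/eqP; rewrite eq_complex /=; apply/andP; split; apply/eqP.
  exact: TE.
rewrite -rdot_imag TE; congr (Rintegral _ _ _); apply/funext => g.
by rewrite rdot_imag.
Qed.

Lemma rdot_op_integral F u v : bounded_weakly_continuous F ->
  rdot u (op_integral mu (F : borel G -> H -> H) v) =
  \int (fun g => rdot u (F g v)).
Proof. by move=> /is_op_integral_op_integral/op_integral_rdot. Qed.

Lemma op_integral_bounded F : bounded_weakly_continuous F ->
  bounded_op (op_integral mu (F : borel G -> H -> H)).
Proof. by move=> /is_op_integral_op_integral[]. Qed.

(** With [w] the value at [v] of the integral, the square of the norm of [w] is
    the integral of [rdot w (F g v)], which is at most [C |w| |v|]. *)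
Lemma rnorm_op_integral F C v : bounded_weakly_continuous F -> 0 <= C ->
  (forall g v, rnorm (F g v) <= C * rnorm v) ->
  rnorm (op_integral mu (F : borel G -> H -> H) v) <= C * rnorm v.
Proof.
move=> wF C0 FC; set w := op_integral _ _ _; have [_ _ cF] := wF.
have [->|w0] := eqVneq (rnorm w) 0; first by rewrite mulr_ge0 ?rnorm_ge0.
have wp : 0 < rnorm w by rewrite lt_neqAle eq_sym w0 rnorm_ge0.
rewrite -(ler_pM2l wp) -expr2 -rdotvv rdot_op_integral//.
apply: le_trans (ler_norm _) _; apply: haar_int_norm_le => // g.
by apply: le_trans (CauchySchwarz _ _) _; rewrite ler_wpM2l ?rnorm_ge0.
Qed.

End OperatorIntegral.

(** * Operator norm and unitary representations *)

Section OperatorNorm.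
Variables (R : realType) (H : hilbertType R).
Implicit Types (T : H -> H) (v : H).

Lemma rnorm_le_opnorm T v : bounded_op T -> rnorm (T v) <= opnorm T * rnorm v.
Proof.
move=> bT; have [_ [C C0 TC]] := (bounded_opP T).1 bT.
have ub : has_ubound [set complex.Re `|T v| | v in [set v : H | `|v| <= 1]].
  exists C => _ [w /= w1 <-]; apply: le_trans (TC _) _.
  by rewrite ler_piMr//; move: w1; rewrite rnormE (lecR _ 1).
have [v0|v0] := eqVneq (rnorm v) 0.
  by rewrite (rnorm_eq0 v0) bounded_op0// rnorm0 mulr0.
have vp : 0 < rnorm v by rewrite lt_neqAle eq_sym v0 rnorm_ge0.
have := ub_le_sup ub (_ : _ (rnorm (T (rscale (rnorm v)^-1 v)))).
rewrite {1}/rscale bounded_opZ// -/(rscale _ _) !rnormZ.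
rewrite ger0_norm ?invr_ge0 ?rnorm_ge0// => le.
rewrite -ler_pdivrMr// mulrC; apply: le.
exists (rscale (rnorm v)^-1 v) => /=.
  rewrite rnormE rnormZ ger0_norm ?invr_ge0 ?rnorm_ge0// mulVf//.
by rewrite /rscale bounded_opZ// -/(rscale _ _) -/(rnorm _) rnormZ ger0_norm
  ?invr_ge0 ?rnorm_ge0.
Qed.

Lemma opnorm_ge0 T : bounded_op T -> 0 <= opnorm T.
Proof.
move=> bT; have [_ [C C0 TC]] := (bounded_opP T).1 bT.
apply: ub_le_sup.
  exists C => _ [w /= w1 <-]; apply: le_trans (TC _) _.
  by rewrite ler_piMr//; move: w1; rewrite rnormE (lecR _ 1).
exists 0; first by rewrite /= normr0.
by rewrite bounded_op0// normr0.
Qed.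

Lemma opnorm_le T (C : R) : 0 <= C -> (forall v, rnorm (T v) <= C * rnorm v) ->
  opnorm T <= C.
Proof.
move=> C0 TC; apply: ge_sup.
  by exists (complex.Re `|T 0|), 0 => //=; rewrite normr0.
move=> _ [w /= w1 <-]; apply: le_trans (TC _) _.
by rewrite ler_piMr//; move: w1; rewrite rnormE (lecR _ 1).
Qed.

End OperatorNorm.

Section UnitaryRepresentation.
Variables (R : realType) (G : topGroupType) (H : hilbertType R).
Variable U : G -> H -> H.
Hypotheses (rU : unitary_representation U).
Implicit Types (T S : H -> H) (u v : H) (g h : G).

Lemma repr_bounded g : bounded_op (U g).
Proof. by case: rU => /(_ g)[]. Qed.

(** Idempotent and unitary, hence the identity. *)
Lemma repr1 : U 1%g = id.
Proof.
have [/(_ 1%g)[_ adU _] UM] := rU; have := UM 1%g 1%g; rewrite mulg1 => U1.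
apply/funext => v; have /= := congr1 (@^~ (U 1%g v)) adU.
have -> : U 1%g (U 1%g v) = U 1%g v by rewrite -[LHS]/((U 1%g \o U 1%g) v) -U1.
by have /= -> := congr1 (@^~ v) adU.
Qed.

Lemma reprM g h v : U g (U h v) = U (g * h)%g v.
Proof. by case: rU => _ ->. Qed.

Lemma reprK g v : U g^-1%g (U g v) = v.
Proof. by rewrite reprM mulVg repr1. Qed.

Lemma reprVK g v : U g (U g^-1%g v) = v.
Proof. by rewrite reprM mulgV repr1. Qed.

Lemma adj_repr g : adj (U g) = U g^-1%g.
Proof.
apply/funext => v; rewrite -{1}(reprVK g v).
by have [/(_ g)[_ adU _] _] := rU; have /= -> := congr1 (@^~ (U g^-1%g v)) adU.
Qed.

Lemma rdot_repr g u v : rdot u (U g v) = rdot (U g^-1%g u) v.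
Proof. by rewrite -adj_repr rdot_adjl//; exact: repr_bounded. Qed.

Lemma rnorm_repr g v : rnorm (U g v) = rnorm v.
Proof.
apply/eqP; rewrite -(eqrXn2 (n := 2)) ?rnorm_ge0//.
by rewrite -!rdotvv rdot_repr reprK.
Qed.

Lemma conj_actionE g T : conj_action U g T = U g \o T \o U g^-1%g.
Proof. by rewrite /conj_action adj_repr. Qed.

Lemma conj_action_bounded g T : bounded_op T -> bounded_op (conj_action U g T).
Proof.
move=> bT; rewrite conj_actionE; apply: bounded_op_comp (repr_bounded _).
exact: bounded_op_comp (repr_bounded _) bT.
Qed.

Lemma rdot_conj_action g T u v :
  rdot u (conj_action U g T v) = rdot (U g^-1%g u) (T (U g^-1%g v)).
Proof. by rewrite conj_actionE /= rdot_repr. Qed.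

Lemma rnorm_conj_action T (C : R) : (forall v, rnorm (T v) <= C * rnorm v) ->
  forall g v, rnorm (conj_action U g T v) <= C * rnorm v.
Proof.
move=> TC g v; rewrite conj_actionE /= rnorm_repr -(rnorm_repr g^-1%g v).
exact: TC.
Qed.

Lemma conj_action_fixP T g : conj_action U g T = T <-> T \o U g = U g \o T.
Proof.
rewrite conj_actionE; split => E; apply/funext => v.
  by rewrite -{1}E /= reprK.
by have /= <- := congr1 (@^~ (U g^-1%g v)) E; rewrite reprVK.
Qed.

Hypothesis cU : strongly_continuous U.

Lemma repr_inv_continuous v : continuous (fun g : G => U g^-1%g v).
Proof.
move=> g; apply: (continuous_comp (f := fun g : G => g^-1%g)
  (g := fun g => U g v)); [exact: invg_continuous|exact: cU].
Qed.

Lemma repr_bwc : bounded_weakly_continuous U.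
Proof.
split; first exact: repr_bounded.
  by exists 1 => // g v; rewrite mul1r rnorm_repr.
by move=> u v g; apply: rdot_cvg; [exact: cvg_cst|exact: cU].
Qed.

Lemma rdot_conj_continuous T u v : bounded_op T ->
  continuous (fun g : G => rdot (U g^-1%g u) (T (U g^-1%g v))).
Proof.
move=> [_ cT] g; apply: rdot_cvg; first exact: repr_inv_continuous.
apply: (continuous_comp (f := fun g : G => U g^-1%g v) (g := T)).
  exact: repr_inv_continuous.
exact: cT.
Qed.

Lemma conj_action_bwc T : bounded_op T ->
  bounded_weakly_continuous (fun g => conj_action U g T).
Proof.
move=> bT; split; first by move=> g; exact: conj_action_bounded.
  have [_ [C C0 TC]] := (bounded_opP T).1 bT.
  by exists C => //; exact: rnorm_conj_action.
move=> u v; under eq_fun do rewrite rdot_conj_action.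
exact: rdot_conj_continuous.
Qed.

End UnitaryRepresentation.

(** * Averaging over the group *)

Section Averaging.
Variables (R : realType) (G : topGroupType) (H : hilbertType R).
Variable mu : {measure set (borel G) -> \bar R}.
Hypotheses (cG : compact [set: G]) (hmu : normalized_haar mu).
Variable U : G -> H -> H.
Hypotheses (rU : unitary_representation U) (cU : strongly_continuous U).
Implicit Types (T S : H -> H) (u v : H) (g h : G).

Local Notation "\int f" := (Rintegral mu setT (f : borel G -> R)) (at level 10).
Local Notation E := (E_G mu U).

Lemma rdot_E_G T u v : bounded_op T -> rdot u (E T v) =
  \int (fun g => rdot (U g^-1%g u) (T (U g^-1%g v))).
Proof.
move=> bT; rewrite /E_G (rdot_op_integral cG hmu); last exact: conj_action_bwc.
by congr (Rintegral _ _ _); apply/funext => g; rewrite rdot_conj_action.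
Qed.

Lemma E_G_bounded T : bounded_op T -> bounded_op (E T).
Proof. by move=> bT; apply: (op_integral_bounded cG hmu); exact: conj_action_bwc. Qed.

(** Conjugation by [U h] translates the integrand by [h]. *)
Lemma conj_action_E_G h T : bounded_op T -> conj_action U h (E T) = E T.
Proof.
move=> bT; apply: op_rdot_ext => u v; rewrite rdot_conj_action// !rdot_E_G//.
rewrite -[RHS](haar_int_translate cG hmu h)//; last exact: rdot_conj_continuous.
congr (Rintegral _ _ _); apply/funext => g.
by rewrite !reprM// invgM.
Qed.

Lemma E_G_id T : bounded_op T -> (forall g, conj_action U g T = T) -> E T = T.
Proof.
move=> bT fT; apply: op_rdot_ext => u v; rewrite rdot_E_G//.
under eq_Rintegral do rewrite -rdot_conj_action// fT.
exact: haar_int_cst.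
Qed.

(** The coefficients of [S T] and [T S] are coefficients of [T] at [(adj S u, v)]
    and [(u, S v)]; membership in a commutant is thus an identity between
    coefficients, and it passes to the integral. *)
Lemma E_G_commutant (M : set (H -> H)) T : (M `<=` bounded_op (R := R) (H := H)) ->
  bounded_op T -> (forall g, commutant M (conj_action U g T)) ->
  commutant M (E T).
Proof.
move=> bM bT cT; split; first exact: E_G_bounded.
move=> S MS; have bS := bM _ MS.
apply: op_rdot_ext => u v /=; rewrite -rdot_adjl// !rdot_E_G//.
congr (Rintegral _ _ _); apply/funext => g.
rewrite -!rdot_conj_action// rdot_adjl//.
by have [_ /(_ _ MS) /(congr1 (@^~ v)) /= ->] := cT g.
Qed.

Lemma rdot_scaler (k : R[i]) u v : rdot u (k *: v) = rdot (k^* *: u) v.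
Proof. by rewrite /rdot innerZl innerZr conjCK. Qed.

Lemma E_G_lin (k : R[i]) S T : bounded_op S -> bounded_op T ->
  E (fun v => k *: S v + T v) = (fun v => k *: E S v + E T v).
Proof.
move=> bS bT; apply: op_rdot_ext => u v.
rewrite rdotDr rdot_scaler !rdot_E_G//; last exact: bounded_op_lin.
rewrite -(haar_intD cG hmu); [|exact: rdot_conj_continuous..].
congr (Rintegral _ _ _); apply/funext => g.
rewrite rdotDr rdot_scaler bounded_opZ//; exact: repr_bounded.
Qed.

Lemma E_G_positive T : positive_op T -> positive_op (E T).
Proof.
move=> [bT pT]; split; first exact: E_G_bounded.
move=> u; rewrite lecE -rdot_imag -[complex.Re ⟨_, _⟩]/(rdot u (E T u)) !rdot_E_G//.
apply/andP; split; last first.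
  apply: Rintegral_ge0 => g _.
  by have := pT (U g^-1%g u); rewrite lecE => /andP[].
rewrite (_ : (fun g => _) = (fun=> 0)) ?haar_int_cst//.
apply/funext => g; rewrite bounded_opZ; last exact: repr_bounded.
by rewrite rdot_imag; have := pT (U g^-1%g u); rewrite lecE => /andP[/eqP].
Qed.

Lemma E_G_opnorm T : bounded_op T -> opnorm (E T) <= opnorm T.
Proof.
move=> bT; apply: opnorm_le; first exact: opnorm_ge0.
move=> v; apply: (rnorm_op_integral cG hmu).
- exact: conj_action_bwc.
- exact: opnorm_ge0.
- by apply: rnorm_conj_action => // w; exact: rnorm_le_opnorm.
Qed.

Lemma E_G_self_adjoint T : self_adjoint T -> self_adjoint (E T).
Proof.
move=> /self_adjointP[bT sT]; apply/self_adjointP; split; first exact: E_G_bounded.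
move=> u v; rewrite [RHS]rdotC !rdot_E_G//.
congr (Rintegral _ _ _); apply/funext => g.
by rewrite sT rdotC.
Qed.

Lemma E_G_bimodule T S S' : bounded_op T -> bounded_op S -> bounded_op S' ->
  (forall g, conj_action U g S = S) -> (forall g, conj_action U g S' = S') ->
  E (S \o T \o S') = S \o E T \o S'.
Proof.
move=> bT bS bS' fS fS'.
apply: op_rdot_ext => u v; rewrite rdot_E_G; last first.
  by apply: bounded_op_comp bS'; exact: bounded_op_comp.
rewrite [RHS]/= -rdot_adjl// rdot_E_G//.
congr (Rintegral _ _ _); apply/funext => g.
rewrite -[RHS]rdot_conj_action// rdot_adjl// -rdot_conj_action//.
have cS w : S (U g w) = U g (S w).
  exact: (congr1 (@^~ w) ((conj_action_fixP rU S g).1 (fS g))).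
have cS' w : S' (U g^-1%g w) = U g^-1%g (S' w).
  exact: (congr1 (@^~ w) ((conj_action_fixP rU S' g^-1%g).1 (fS' _))).
by rewrite !conj_actionE//= cS' cS.
Qed.

(** [P_G] projects onto the vectors fixed by [U], again by translation
    invariance. *)
Lemma repr_P_G h v : U h (P_G mu U v) = P_G mu U v.
Proof.
have bwc := repr_bwc rU cU.
apply: rdot_inj => u; rewrite rdot_repr// /P_G !(rdot_op_integral cG hmu)//.
have [_ _ cUw] := bwc.
rewrite -[RHS](haar_int_translate cG hmu h)//.
by congr (Rintegral _ _ _); apply/funext => g; rewrite -rdot_repr// reprM.
Qed.

(** Since [U g^-1] fixes [Phi_G], the integrand defining
    [⟨Phi_G, E T Phi_G⟩] does not depend on [g]. *)
Lemma psi_G_E_G Phi T : bounded_op T -> psi_G mu U Phi (E T) = psi_G mu U Phi T.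
Proof.
move=> bT; rewrite /psi_G /Phi_G; congr (_ * _).
have fixed g : U g^-1%g (P_G mu U Phi) = P_G mu U Phi by exact: repr_P_G.
apply: rdot_inner_eq; rewrite rdot_E_G//.
  under eq_Rintegral do rewrite fixed.
  exact: haar_int_cst.
under eq_Rintegral do rewrite (bounded_opZ _ _ (repr_bounded rU _)) fixed.
exact: haar_int_cst.
Qed.

End Averaging.

(** * Increasing nets and normality *)

Section IncreasingNets.
Variables (R : realType) (H : hilbertType R).
Implicit Types (S T : H -> H) (u v w : H) (D M : set (H -> H)).

(** The limit of a net given by the directed set [D] of its values is the limit
    along this filter. *)
Definition tails D : set_system (H -> H) :=
  filter_from D (fun S0 => [set S | D S /\ op_le S0 S]).

Lemma op_le_trans S T V : self_adjoint S -> self_adjoint T -> self_adjoint V ->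
  op_le S T -> op_le T V -> op_le S V.
Proof.
move=> sS sT sV /(op_leP sS sT) ST /(op_leP sT sV) TV.
by apply/(op_leP sS sV) => v; exact: le_trans (ST v) (TV v).
Qed.

Lemma tails_proper D : D !=set0 -> D `<=` @self_adjoint R H -> directed D ->
  ProperFilter (tails D).
Proof.
move=> [S0 DS0] saD dD; apply: filter_from_proper; last first.
  by move=> S DS; have [V [DV SV _]] := dD _ _ DS DS; exists V.
apply: filter_from_filter; first by exists S0.
move=> S T DS DT; have [V [DV SV TV]] := dD _ _ DS DT; exists V => // W [DW VW].
by split; split => //; apply: op_le_trans VW => //; exact: saD.
Qed.

Lemma tails_mem D : D !=set0 -> tails D D.
Proof. by move=> [S DS]; exists S => // T []. Qed.

(** Rescaling both arguments to unit vectors turns the first bound into the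
    second. *)
Lemma bilinear_bound (s : H -> H -> R) (K : R) :
  (forall t u v, s (rscale t u) v = t * s u v) ->
  (forall t u v, s u (rscale t v) = t * s u v) ->
  (forall u v, `|s u v| <= K * (rnorm u ^+ 2 + rnorm v ^+ 2)) ->
  forall u v, `|s u v| <= 2 * K * rnorm u * rnorm v.
Proof.
move=> sZl sZr sK u v.
have r0 w : rscale 0 w = 0 by rewrite /rscale scale0r.
have [u0|u0] := eqVneq (rnorm u) 0.
  by rewrite (rnorm_eq0 u0) -(r0 0) sZl mul0r normr0 rnormZ normr0 !(mul0r,mulr0).
have [v0|v0] := eqVneq (rnorm v) 0.
  by rewrite (rnorm_eq0 v0) -(r0 0) sZr mul0r normr0 rnormZ normr0 !(mul0r,mulr0).
have up : 0 < rnorm u by rewrite lt_neqAle eq_sym u0 rnorm_ge0.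
have vp : 0 < rnorm v by rewrite lt_neqAle eq_sym v0 rnorm_ge0.
have := sK (rscale (rnorm u)^-1 u) (rscale (rnorm v)^-1 v).
have inv w : `|(rnorm w)^-1| = (rnorm w)^-1.
  by rewrite ger0_norm ?invr_ge0 ?rnorm_ge0.
rewrite sZl sZr !rnormZ !normrM !inv !mulVf// expr1n mulrA -invfM mulrC.
rewrite ler_pdivrMr ?mulr_gt0// => le.
by apply: le_trans le _; rewrite le_eqVlt; apply/orP; left; apply/eqP; ring.
Qed.

(** This is Vigier's theorem: the pointwise supremum [q] of the quadratic forms
    of the net is the form of an operator [T0]; the coefficients of [T0] are
    limits of those of the net, so [T0] is in [M]; hence [T <= T0] and
    [rdot v (T v) <= q v]. *)
Lemma lub_pointwise M D T : von_neumann_algebra M -> D !=set0 ->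
  D `<=` M `&` @self_adjoint R H -> directed D -> is_lub M D T ->
  forall v (e : R), 0 < e ->
    exists2 S, D S & rdot v (T v) - e < rdot v (S v).
Proof.
move=> [_ bcM] D0 DM dD [MT sT ubT lubT].
have saD S : D S -> self_adjoint S by move=> /DM[].
have bD S : D S -> bounded_op S by move=> /saD[].
have bT : bounded_op T by case: sT.
have FF : ProperFilter (tails D) by exact: tails_proper.
have FD := tails_mem D0.
have [S0 DS0] := D0.
pose q v := sup [set rdot v (S v) | S in D].
have le_T S v : D S -> rdot v (S v) <= rdot v (T v).
  by move=> DS; exact: (op_leP (saD _ DS) sT).1 (ubT _ DS) v.
have supq v : has_sup [set rdot v (S v) | S in D].
  split; first by exists (rdot v (S0 v)), S0.
  by exists (rdot v (T v)) => _ [S DS <-]; exact: le_T.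
have le_q S v : D S -> rdot v (S v) <= q v.
  by move=> DS; apply: (ub_le_sup (supq v).2); exists S.
have q_le v : q v <= rdot v (T v).
  by apply: (ge_sup (supq v).1) => _ [S DS <-]; exact: le_T.
have q_cvg v : (fun S => rdot v (S v)) @ tails D --> q v.
  apply/cvgrPdist_lt => e e0; have [_ [S DS <-] Se] := sup_adherent e0 (supq v).
  exists S => // V [DV SV]; rewrite ger0_norm ?subr_ge0 ?le_q//.
  have := (op_leP (saD _ DS) (saD _ DV)).1 SV v.
  by move: Se; rewrite -/(q v); lra.
pose s u v := (q (u + v) - q (u - v)) / 4.
have s_cvg u v : (fun S => rdot u (S v)) @ tails D --> s u v.
  apply: cvg_trans (_ : (fun S => (rdot (u + v) (S (u + v)) -
      rdot (u - v) (S (u - v))) / 4) @ tails D --> s u v).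
    apply: near_eq_cvg; near=> S; apply/esym/self_adjoint_polar/saD.
    by near: S.
  by apply: cvgMr_tmp; apply: cvgB; exact: q_cvg.
have s_eq (f g : (H -> H) -> R) (a b : R) :
    f @ tails D --> a -> g @ tails D --> b -> (forall S, D S -> f S = g S) -> a = b.
  move=> fa gb fg; have ga : f @ tails D --> b.
    apply: cvg_trans gb; apply: near_eq_cvg; near=> S; apply/esym/fg.
    by near: S.
  exact: (cvg_unique _ fa ga).
have sDl u u' v : s (u + u') v = s u v + s u' v.
  apply: (s_eq _ _ _ _ (s_cvg _ _) (cvgD (s_cvg u v) (s_cvg u' v))) => S DS.
  by rewrite rdotDl.
have sDr u v v' : s u (v + v') = s u v + s u v'.
  apply: (s_eq _ _ _ _ (s_cvg _ _) (cvgD (s_cvg u v) (s_cvg u v'))) => S DS.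
  by rewrite (bounded_opD _ _ (bD _ DS)) rdotDr.
have sZl t u v : s (rscale t u) v = t * s u v.
  apply: (s_eq _ _ _ _ (s_cvg _ _) (cvgM (cvg_cst t) (s_cvg u v))) => S DS.
  by rewrite rdotZl.
have sZr t u v : s u (rscale t v) = t * s u v.
  apply: (s_eq _ _ _ _ (s_cvg _ _) (cvgM (cvg_cst t) (s_cvg u v))) => S DS.
  by rewrite /rscale (bounded_opZ _ _ (bD _ DS)) rdotZr.
have si u v : s (imag_unit R *: u) (imag_unit R *: v) = s u v.
  apply: (s_eq _ _ _ _ (s_cvg _ _) (s_cvg u v)) => S DS.
  by rewrite (bounded_opZ _ _ (bD _ DS)) rdot_imag2.
have sC u v : s u v = s v u.
  apply: (s_eq _ _ _ _ (s_cvg _ _) (s_cvg _ _)) => S DS.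
  by rewrite [RHS]rdotC; exact: ((self_adjointP S).1 (saD _ DS)).2.
have sq v : s v v = q v by exact: (cvg_unique _ (s_cvg v v) (q_cvg v)).
have [_ [C0 C00 S0C]] := (bounded_opP S0).1 (bD _ DS0).
have [_ [C1 C10 TC]] := (bounded_opP T).1 bT.
have form_le (V : H -> H) C v : 0 <= C ->
    (forall v, rnorm (V v) <= C * rnorm v) ->
    `|rdot v (V v)| <= C * rnorm v ^+ 2.
  move=> CC VC; apply: le_trans (CauchySchwarz _ _) _.
  by rewrite expr2 mulrCA ler_wpM2l ?rnorm_ge0.
have q_bound v : `|q v| <= (C0 + C1) * rnorm v ^+ 2.
  have := form_le _ _ v C00 S0C; have := form_le _ _ v C10 TC.
  rewrite !ler_norml => /andP[_ h1] /andP[h2 _].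
  have h3 := le_q _ v DS0; have h4 := q_le v.
  have p0 : 0 <= C0 * rnorm v ^+ 2 by rewrite mulr_ge0 ?sqr_ge0.
  have p1 : 0 <= C1 * rnorm v ^+ 2 by rewrite mulr_ge0 ?sqr_ge0.
  by apply/andP; split; lra.
have s_bound u v : `|s u v| <= (C0 + C1) / 2 * (rnorm u ^+ 2 + rnorm v ^+ 2).
  have := q_bound (u + v); have := q_bound (u - v).
  have -> : (C0 + C1) / 2 * (rnorm u ^+ 2 + rnorm v ^+ 2) =
    ((C0 + C1) * rnorm (u + v) ^+ 2 + (C0 + C1) * rnorm (u - v) ^+ 2) / 4.
    by rewrite -mulrDr parallelogram; field.
  rewrite /s !ler_norml => /andP[h1 h2] /andP[h3 h4].
  by apply/andP; split; lra.
have K0 : 0 <= 2 * ((C0 + C1) / 2) by rewrite mulrC divfK// addr_ge0.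
have [T0 bT0 T0s] := form_operator K0 sDl sZl sDr sZr si
  (bilinear_bound sZl sZr s_bound).
have sT0 : self_adjoint T0.
  by apply/self_adjointP; split => // u v; rewrite [RHS]rdotC !T0s sC.
have MT0 : M T0.
  rewrite -bcM; split => // B MB; have [bB cB] := MB.
  apply: op_rdot_ext => u v /=; rewrite -[LHS]rdot_adjl// !T0s.
  apply: (s_eq _ _ _ _ (s_cvg _ _) (s_cvg _ _)) => S DS.
  rewrite rdot_adjl//; have [MS _] := DM _ DS.
  by rewrite -[B (S v)](congr1 (@^~ v) (cB _ MS)).
have qT v : rdot v (T v) <= q v.
  rewrite -sq -T0s; apply: (op_leP sT sT0).1; apply: lubT => // S DS.
  by apply/(op_leP (saD _ DS) sT0) => w; rewrite T0s sq; exact: le_q.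
move=> v e e0; have [_ [S DS <-] Se] := sup_adherent e0 (supq v).
by exists S => //; apply: le_lt_trans Se; rewrite lerB.
Unshelve. all: by end_near. Qed.

End IncreasingNets.

Section Normality.
Variables (R : realType) (G : topGroupType) (H : hilbertType R).
Variable mu : {measure set (borel G) -> \bar R}.
Hypotheses (cG : compact [set: G]) (hmu : normalized_haar mu).
Variable U : G -> H -> H.
Hypotheses (rU : unitary_representation U) (cU : strongly_continuous U).
Local Notation E := (E_G mu U).

Lemma E_G_monotone (S T : H -> H) : self_adjoint S -> self_adjoint T ->
  op_le S T -> op_le (E S) (E T).
Proof.
move=> sS sT /(op_leP sS sT) ST.
apply/op_leP; [exact: E_G_self_adjoint..|].
have [[bS _] [bT _]] := (sS, sT).
move=> v; rewrite !rdot_E_G//; apply: (haar_int_le cG hmu).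
- exact: rdot_conj_continuous.
- exact: rdot_conj_continuous.
- by move=> g; exact: ST.
Qed.

(** Minimality of [E T] among the upper bounds is Dini's theorem. Given [e > 0],
    every [g] has some [S] in the net whose form is within [e] of that of [T] at
    [U g^-1 v]; by continuity this persists near [g], by monotonicity it persists
    for larger [S], and compactness makes one [S] good for all [g]. *)
Lemma E_G_normal (M N : set (H -> H)) : von_neumann_algebra M ->
  (forall T, M T -> N (E T)) -> normal_map M N E.
Proof.
move=> vM EMN D T D0 DM dD lubT; have [MT sT ubT _] := lubT.
have saD S : D S -> self_adjoint S by move=> /DM[].
split; [exact: EMN|exact: E_G_self_adjoint| |].
  by move=> _ [S DS <-]; apply: E_G_monotone => //; [exact: saD|exact: ubT].
move=> T' NT' sT' ubT'.
apply/(op_leP (E_G_self_adjoint cG hmu rU cU sT) sT') => v.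
have [bT _] := sT.
have FF : ProperFilter (tails D) by exact: tails_proper.
apply/ler_addgt0Pr => e e0.
pose P (S : H -> H) g := rdot (U g^-1%g v) (T (U g^-1%g v)) -
  rdot (U g^-1%g v) (S (U g^-1%g v)) < e.
have : \forall S \near tails D, [set: G] `<=` P S.
  apply: ((compact_near_coveringP _).1 cG) => g _.
  have [S DS Sg] := lub_pointwise vM D0 DM dD lubT (U g^-1%g v) e0.
  have [bS _] := saD _ DS.
  exists ([set h | P S h], [set V | D V /\ op_le S V]); last first.
    move=> [h V] [/= PSh [DV /(op_leP (saD _ DS) (saD _ DV))]].
    by move=> /(_ (U h^-1%g v)); move: PSh; rewrite /P; lra.
  split; last by exists S.
  have cSg : (fun g => rdot (U g^-1%g v) (T (U g^-1%g v)) -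
      rdot (U g^-1%g v) (S (U g^-1%g v))) @ g -->
      rdot (U g^-1%g v) (T (U g^-1%g v)) - rdot (U g^-1%g v) (S (U g^-1%g v)).
    by apply: cvgB; apply: rdot_conj_continuous.
  by apply: (cvgr_lt _ cSg); lra.
move=> /(filterI (tails_mem D0))/filter_ex[S [DS PS]].
have [bS _] := saD _ DS.
have : rdot v (E S v) <= rdot v (T' v).
  apply: (op_leP (E_G_self_adjoint cG hmu rU cU (saD _ DS)) sT').1.
  by apply: ubT'; exists S.
rewrite -(lerD2r e); apply: le_trans; rewrite !rdot_E_G//.
rewrite -[X in _ + X](haar_int_cst hmu) -haar_intD//; last 2 first.
- exact: rdot_conj_continuous.
- by move=> ?; exact: cvg_cst.
apply: haar_int_le => //; first exact: rdot_conj_continuous.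
  move=> g; apply: cvgD; last exact: cvg_cst.
  exact: rdot_conj_continuous.
by move=> g; have := PS g I; rewrite /P; lra.
Qed.

End Normality.

(** * The fixed-point algebra of a covariant representation *)

(** The set where two bounded operators differ is open, and so meets every dense
    set if it is not empty. *)
Lemma bounded_op_dense (R : realType) (H : hilbertType R) (S T : H -> H)
    (A : set H) : dense A -> bounded_op S -> bounded_op T ->
  (forall v, A v -> S v = T v) -> S = T.
Proof.
move=> dA [_ cS] [_ cT] ST; apply/funext => v; apply/subr0_eq/rnorm_eq0.
apply/eqP; case: eqVneq => // v0; exfalso.
pose f w := rnorm (S w - T w).
have cf : continuous f.
  move=> w; apply: (continuous_comp (f := fun w => S w - T w) (g := @rnorm R H)).
    by apply: cvgB; [exact: cS|exact: cT].
  exact: rnorm_continuous.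
have oO : open (f @^-1` [set r | 0 < r]).
  by have /continuousP := cf; apply; exact: open_gt.
have [|w [fw Aw]] := dA _ _ oO.
  by exists v; rewrite /= /f lt_neqAle eq_sym v0 rnorm_ge0.
by move: fw; rewrite /= /f ST// subrr rnorm0 ltxx.
Qed.

Section GNSFixedAlgebra.
Variables (R : realType) (G : topGroupType) (A : cstarAlgType R).
Variables (H : hilbertType R) (pi : A -> H -> H) (U : G -> H -> H).
Hypotheses (rpi : star_representation pi) (rU : unitary_representation U).

Lemma gns_vN_von_neumann : von_neumann_algebra (gns_vN pi).
Proof.
have [bpi _ _ api] := rpi.
have bpi' : range pi `<=` bounded_op (R := R) (H := H) by move=> _ [a _ <-].
apply: commutant_von_neumann => [T|T]; first exact: commutant_bounded.
by apply: commutant_adj => // _ [a _ <-]; exists (cstar a) => //; rewrite api.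
Qed.

Lemma gns_vN_bounded T : gns_vN pi T -> bounded_op T.
Proof. exact: commutant_bounded. Qed.

(** Being fixed by conjugation with [U g] means commuting with [U g]. *)
Lemma fix_algebraE :
  fix_algebra pi U = commutant (commutant (range pi) `|` range U).
Proof.
apply/seteqP; split => T.
  move=> [[bT cT] fT]; split => // S [/cT//|[g _ <-]].
  exact/esym/(conj_action_fixP rU).
move=> [bT cT]; split; first by split => // S XS; apply: cT; left.
by move=> g; apply/(conj_action_fixP rU)/esym/cT; right; exists g.
Qed.

Lemma fix_algebra_von_neumann : von_neumann_algebra (fix_algebra pi U).
Proof.
have [bpi _ _ api] := rpi.
have bpi' : range pi `<=` bounded_op (R := R) (H := H) by move=> _ [a _ <-].
rewrite fix_algebraE; apply: commutant_von_neumann => T.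
  by move=> [/commutant_bounded//|[g _ <-]]; exact: repr_bounded.
move=> [XT|[g _ <-]]; last by right; exists g^-1%g => //; rewrite adj_repr.
left; apply: commutant_adj XT => // _ [a _ <-].
by exists (cstar a) => //; rewrite api.
Qed.

(** Covariance lets [U g] normalise [range pi], hence its commutant, hence its
    bicommutant. *)
Lemma conj_action_gns_vN (alpha : G -> A -> A) :
  (forall g a v, U g (pi a v) = pi (alpha g a) (U g v)) ->
  forall g T, gns_vN pi T -> gns_vN pi (conj_action U g T).
Proof.
move=> cov g T [bT cT]; split; first exact: conj_action_bounded.
move=> S [bS cS].
have bS' := conj_action_bounded rU g^-1%g bS.
have XS' : commutant (range pi) (conj_action U g^-1%g S).
  split => // _ [a _ <-]; apply/funext => v.
  rewrite conj_actionE//= invgK cov.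
  have /(congr1 (@^~ (U g v))) /= <- := cS (pi (alpha g a)) (imageT _ _).
  by rewrite -[LHS](reprK rU g) (cov g a) reprVK.
apply/funext => v; rewrite !conj_actionE//=.
have /(congr1 (@^~ (U g^-1%g v))) := cT _ XS'.
rewrite conj_actionE//= invgK reprVK// => <-.
by rewrite reprVK.
Qed.

End GNSFixedAlgebra.

(** On the dense set of vectors [pi b Phi] this is multiplicativity of [alpha g],
    as the factor [s g] stands on the right and stays untouched. *)
Lemma gns_covariant (R : realType) (G : topGroupType) (A : cstarAlgType R)
    (alpha : G -> A -> A) (s : G -> A) (phi : A -> R[i])
    (H : hilbertType R) (pi : A -> H -> H) (Phi : H) (U : G -> H -> H) :
  (forall g a b, alpha g (a ** b) = alpha g a ** alpha g b) ->
  gns_representation phi pi Phi -> unitary_representation U ->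
  (forall g a, U g (pi a Phi) = pi (alpha g a ** s g) Phi) ->
  forall g a v, U g (pi a v) = pi (alpha g a) (U g v).
Proof.
move=> aM [[bpi _ piM _] dPhi _] rU UE g a v.
have bU := repr_bounded rU g.
have : U g \o pi a = pi (alpha g a) \o U g.
  apply: (bounded_op_dense dPhi); try exact: bounded_op_comp.
  move=> _ [b _ <-] /=.
  have M c d w : pi c (pi d w) = pi (c ** d) w by rewrite piM.
  by rewrite M !UE M aM cmulA.
by move/(congr1 (@^~ v)).
Qed.

Theorem theorem2p5 (R : realType)
    (G : topGroupType) (mu : {measure set (borel G) -> \bar R})
    (A : cstarAlgType R) (alpha : G -> A -> A)
    (phi : A -> R[i]) (x : G -> A)
    (H : hilbertType R) (pi : A -> H -> H) (Phi : H)
    (U : G -> H -> H) :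
  compact [set: G] -> hausdorff_space G -> normalized_haar mu ->
  automorphism_group alpha ->
  faithful_state phi -> strongly_quasi_invariant alpha phi x ->
  gns_representation phi pi Phi ->
  unitary_representation U ->
  (forall g a, U g (pi a Phi) = pi (alpha g a ** csqrt (x g^-1%g)) Phi) ->
  continuous x -> strongly_continuous U ->
  (forall T, gns_vN pi T ->
     is_op_integral mu (fun g : borel G => conj_action U g T) (E_G mu U T)) /\
  umegaki_expectation (gns_vN pi) (psi_G mu U Phi) (fix_algebra pi U)
    (E_G mu U).
Proof.
move=> cG _ hmu [aut _ _] _ _ gns rU UE _ cU.
have [rpi _ _] := gns.
have aM g a b : alpha g (a ** b) = alpha g a ** alpha g b.
  by have [_ ->] := aut g.
have cov := gns_covariant aM gns rU UE.
have vM := gns_vN_von_neumann rpi.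
have bM T : gns_vN pi T -> bounded_op T by exact: gns_vN_bounded.
have NM : fix_algebra pi U `<=` gns_vN pi by move=> T [].
have EN T : gns_vN pi T -> fix_algebra pi U (E_G mu U T).
  move=> MT; have bT := bM _ MT; split; last first.
    by move=> g; exact: conj_action_E_G.
  apply: (E_G_commutant cG hmu rU cU _ bT); first exact: commutant_bounded.
  by move=> g; exact: (conj_action_gns_vN rU cov).
have Eid T : fix_algebra pi U T -> E_G mu U T = T.
  by move=> [MT fT]; apply: (E_G_id cG hmu) => //; exact: bM.
split.
  move=> T MT; apply: (is_op_integral_op_integral cG hmu).
  exact/conj_action_bwc/bM.
split => //.
- by split => //; exact: fix_algebra_von_neumann.
- by move=> k S T /bM bS /bM bT; exact: E_G_lin.
- apply/seteqP; split => [_ [T MT <-]|T NT]; first exact: EN.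
  by exists T; [exact: NM|exact: Eid].
- by move=> T _; exact: E_G_positive.
- by move=> T /bM bT; exact: E_G_opnorm.
- exact: E_G_normal.
- move=> T S S' /bM bT [/bM bS fS] [/bM bS' fS']; exact: E_G_bimodule.
- by move=> T /bM bT; exact: psi_G_E_G.
Qed.
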